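(* Let $X$ be a first-countable $\omega$-well-filtered space. Then every irreducible closed subset of $X$ is countably-directed with respect to the specialization order of $X$. Therefore, $X$ is an $\omega^\ast$-$\mathsf{DC}$ space.
   Context: For a $T_0$ space $X$, the specialization order is $x\le y$ iff $x\in\overline{\{y\}}$; a subset is saturated if it is an upper set in this order (equivalently, an intersection of open sets). $\mathsf{K}(X)$ is the set of all nonempty compact saturated subsets of $X$. A family $\mathcal K\subseteq\mathsf K(X)$ is filtered if it is nonempty and for all $K_1,K_2\in\mathcal K$ there is $K_3\in\mathcal K$ with $K_3\subseteq K_1\cap K_2$. A $T_0$ space $X$ is $\omega$-well-filtered if for every countable filtered family $\{K_i: i<\omega\}\subseteq\mathsf K(X)$ and every open $U\subseteq X$, $\bigcap_{i<\omega}K_i\subseteq U$ implies $K_{i_0}\subseteq U$ for some $i_0<\omega$. A nonempty set $A\subseteq X$ is irreducible if whenever $A\subseteq F_1\cup F_2$ with $F_1,F_2$ closed, then $A\subseteq F_1$ or $A\subseteq F_2$. A nonempty subset $D$ of a poset is countably-directed if every nonempty countable subset of $D$ has an upper bound in $D$. A $T_0$ space $X$ is an $\omega^\ast$-$\mathsf{DC}$ space if the irreducible closed subsets of $X$ are exactly the closures of the countably-directed (in the specialization order) subsets of $X$; that is, for each irreducible closed $A$ there is a countably-directed $D\subseteq X$ with $A=\overline D$. *)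

(* Defs.v *)
From HB Require Import structures.
From mathcomp Require Import all_boot all_order all_algebra.
From mathcomp Require Import all_classical all_reals all_analysis.

Set Implicit Arguments.
Unset Strict Implicit.
Unset Printing Implicit Defensive.

Local Open Scope classical_set_scope.

Definition countably_directed {T : Type} (le : T -> T -> Prop) (D : set T) :
    Prop :=
  D !=set0 /\
  forall C : set T, C !=set0 -> countable C -> C `<=` D ->
    exists2 u, D u & forall x, C x -> le x u.

Definition filtered_family {T : Type} (KK : set (set T)) : Prop :=
  KK !=set0 /\
  forall K1 K2, KK K1 -> KK K2 -> exists2 K3, KK K3 & K3 `<=` K1 `&` K2.

Section Spaces.
Context {X : topologicalType}.

Definition spec_le (x y : X) : Prop := closure [set y] x.

Definition saturated (A : set X) : Prop :=
  forall x y, A x -> spec_le x y -> A y.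

(* [compact] is the filter-based notion, with no separation property; it agrees
   with the open-cover one by [compact_cover], stated there for pointed spaces,
   which is harmless here as K is nonempty. *)
Definition compact_saturated : set (set X) :=
  [set K | [/\ K !=set0, compact K & saturated K]].

Definition irreducible_set (A : set X) : Prop :=
  A !=set0 /\
  forall F1 F2 : set X, closed F1 -> closed F2 ->
    A `<=` F1 `|` F2 -> A `<=` F1 \/ A `<=` F2.

End Spaces.

Definition first_countable (X : topologicalType) : Prop :=
  forall x : X, exists B : set (set X),
    [/\ countable B, B `<=` nbhs x &
        forall V, nbhs x V -> exists2 U, B U & U `<=` V].

(* A nonempty countable family is the range of a sequence, possibly with
   repetitions. *)
Definition omega_well_filtered (X : topologicalType) : Prop :=
  kolmogorov_space X /\
  forall K : nat -> set X,
    (forall i, compact_saturated (K i)) -> filtered_family (range K) ->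
    forall U : set X, open U -> \bigcap_i K i `<=` U ->
      exists i0, K i0 `<=` U.

Definition omega_star_DC (X : topologicalType) : Prop :=
  kolmogorov_space X /\
  forall A : set X,
    (closed A /\ irreducible_set A) <->
    (exists2 D : set X, countably_directed spec_le D & A = closure D).

(* Main.v *)
(* Let [c] enumerate a countable subset of the irreducible closed set [A], and
   give every point a shrinking neighbourhood basis. Irreducibility allows us to
   choose recursively [x n] in [A] inside the [n]-th basic neighbourhoods of
   [c i] and [x i] for all [i < n]. Then [x] converges to every [c i] and, more
   importantly, to every [x i], so the saturations of its tails are compact.
   They all meet [A], hence by omega-well-filteredness so does their
   intersection, and any point of that intersection is above every [c i]. *)
Require Import Defs.
From mathcomp Require Import all_boot all_order all_algebra.
From mathcomp Require Import all_classical all_reals all_analysis.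

Local Open Scope classical_set_scope.

Lemma spec_leP (X : topologicalType) (x y : X) :
  spec_le x y <-> forall B, nbhs x B -> B y.
Proof.
split=> [xy B /xy[_ [-> //]]|xy B /xy By].
by exists y.
Qed.

Lemma spec_le_refl (X : topologicalType) (x : X) : spec_le x x.
Proof. by apply/spec_leP => B /nbhs_singleton. Qed.

Lemma spec_le_trans (X : topologicalType) (y x z : X) :
  spec_le x y -> spec_le y z -> spec_le x z.
Proof.
move=> /spec_leP xy /spec_leP yz; apply/spec_leP => B /nbhs_interior /xy.
exact: yz.
Qed.

Lemma closed_spec_le (X : topologicalType) (F : set X) (x y : X) :
  closed F -> spec_le x y -> F y -> F x.
Proof.
move=> cF xy Fy; apply: cF; apply: closureS xy.
by move=> _ ->.
Qed.

Lemma countable_range (T : Type) (B : set T) :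
  B !=set0 -> countable B -> exists e : nat -> T, B = range e.
Proof.
move=> [x0 Bx0] /countable_injP[f finj].
have /choice[e eP] n : exists y, B y /\ forall x, B x -> f x = n -> x = y.
  have [[y [By fy]]|nex] := pselect (exists y, B y /\ f y = n).
    exists y; split=> // x Bx fx.
    by apply: finj; rewrite ?inE // fx.
  by exists x0; split=> // x Bx fx; case: nex; exists x.
exists e; apply/seteqP; split=> [x Bx|_ [n _ <-]]; last by case: (eP n).
by exists (f x) => //; apply/esym; have [_] := eP (f x); exact.
Qed.

Lemma first_countable_seq_basis (X : topologicalType) (x : X) :
  first_countable X ->
  exists U : nat -> set X, (forall n, nbhs x (U n)) /\
    forall V, nbhs x V -> \forall n \near \oo, U n `<=` V.
Proof.
move=> /(_ x)[B [cB Bx Bbasis]].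
have [V0 BV0 _] := Bbasis setT filterT.
have [e eB] := countable_range _ B (ex_intro _ V0 BV0) cB.
have Be i : B (e i) by rewrite eB; exists i.
(* Intersecting the first [n.+1] basic sets makes the basis decreasing, so that one set inside [V]
   puts all later ones there. *)
exists (fun n => [set z | forall i : 'I_n.+1, e i z]); split.
  by move=> n; apply: filter_forall => i; exact/Bx.
move=> V /Bbasis[_ /[!eB] -[i _ <-] eV].
exists i => // n /= lein z Uz; apply: eV.
by have := Uz (Ordinal (lein : (i < n.+1)%N)).
Qed.

Lemma irreducible_meet_nbhs (X : topologicalType) (A : set X) (s : seq X)
    (V : X -> set X) :
  irreducible_set A -> (forall y, y \in s -> A y /\ nbhs y (V y)) ->
  exists2 x, A x & forall y, y \in s -> V y x.
Proof.
move=> [[a Aa] Airr] sV.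
pose W y := interior (V y).
suff [x Ax Wx] : exists2 x, A x & forall y, y \in s -> W y x.
  by exists x => // y /Wx; exact: interior_subset.
pose O (s : seq X) := [set x | forall y, y \in s -> W y x].
have oO t : open (O t).
  elim: t => [|y t oOt].
    by rewrite (_ : O _ = setT) -?subTset; [exact: openT|].
  rewrite (_ : O _ = W y `&` O t); first exact: openI (open_interior _) oOt.
  apply/seteqP; split=> [x Ox|x [Wx Ox] z /predU1P[-> //|]]; last exact: Ox.
  by split=> [|z tz]; apply: Ox; rewrite inE ?eqxx ?tz ?orbT.
suff: A `&` O s !=set0 by move=> [x [Ax Ox]]; exists x.
elim: s sV => [_|y s IHs sV]; first by exists a.
have [Ay Vy] := sV y (mem_head y s).
have [x [Ax Ox]] := IHs (fun z sz => sV z (mem_behead (s := y :: s) sz)).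
(* Otherwise the complements of the open sets [W y] and [O s] would cover [A], and one alone would
   contain it, yet [A] meets both. *)
apply: contrapT => AO0.
have [|AW|AO] := Airr (~` W y) (~` O s)
  (open_closedC (open_interior _)) (open_closedC (oO s)).
- move=> z Az; have [Wz|] := pselect (W y z); last by left.
  by right=> Oz; apply: AO0; exists z; split=> // w /predU1P[->|/Oz].
- exact: AW Ay Vy.
- exact: AO Ax Ox.
Qed.

(** A neighbourhood of the limit [x n] absorbs all but finitely many terms, and a neighbourhood of a
    term contains every point above it. So finitely many neighbourhoods of terms cover the whole
    saturation. *)
Lemma tail_compact_saturated (X : topologicalType) (x : nat -> X) (n : nat) :
  x @ \oo --> x n ->
  compact_saturated [set z | exists2 m, (n <= m)%N & spec_le (x m) z].
Proof.
move=> xn; split.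
- by exists (x n); exists n => //; exact: spec_le_refl.
- move=> F PF FK; apply: contrapT => K0.
  have /choice[B BP] m : exists B, (n <= m)%N -> nbhs (x m) B /\ F (~` B).
    have [lenm|_] := boolP (n <= m)%N; last by exists setT.
    apply: contrapT => nB; apply: K0; exists (x m).
    split=> [|C B FC xB]; first by exists m => //; exact: spec_le_refl.
    apply: contrapT => CB0; apply: nB; exists B; split=> //.
    by apply: filterS FC => z Cz Bz; apply: CB0; exists z.
  have [Bn _] := BP n (leqnn n).
  (* With the interior, [B n] is a neighbourhood of each late [x m], hence contains the points [z]
     above [x m], not just [x m]. *)
  have [M _ MB] : \forall m \near \oo, interior (B n) (x m).
    exact: xn (nbhs_interior Bn).
  have FB : F [set z | forall i : 'I_M, (n <= i)%N -> ~ B i z].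
    apply: filter_forall => i.
    have [leni|_] := boolP (n <= i)%N; last by apply: filterE.
    by have [_] := BP i leni; apply: filterS.
  have [z [[[m lenm /spec_leP xz] nBn] nB]] :=
    filter_ex (filterI (filterI FK (BP n (leqnn n)).2) FB).
  have [ltmM|leMm] := ltnP m M.
    by apply: (nB (Ordinal ltmM) lenm); apply: xz; have [] := BP m lenm.
  by apply: nBn; apply: xz; exact: MB.
- move=> y z [m lenm xy] yz; exists m => //; exact: spec_le_trans xy yz.
Qed.

Lemma irreducible_seq (X : topologicalType) (A : set X) (c : nat -> X) :
  first_countable X -> irreducible_set A -> (forall n, A (c n)) ->
  exists x : nat -> X, [/\ forall n, A (x n),
    forall n, x @ \oo --> x n & forall n, x @ \oo --> c n].
Proof.
move=> fcX Airr Ac.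
have /choice[U UP] := fun x => first_countable_seq_basis X x fcX.
(* The guard on [p.2] makes [g] total; [c 0] is a dummy value for lists not contained in [A]. *)
have /choice[g gP] (p : nat * seq X) : exists x, (forall y, y \in p.2 -> A y) ->
    A x /\ forall y, y \in p.2 -> U y p.1 x.
  have [pA|] := pselect (forall y, y \in p.2 -> A y); last by exists (c 0%N).
  have [|x Ax Ux] := irreducible_meet_nbhs X A p.2 (fun y => U y p.1) Airr.
    by move=> y py; split; [exact: pA|exact: (UP y).1].
  by exists x.
(* [h n] lists the points whose [n]-th basic neighbourhood must contain the
   [n]-th term. *)
pose h := fix h n := if n is m.+1 then [:: g (m, h m), c m & h m] else [::].
pose x n := g (n, h n).
have hA n y : y \in (h n) -> A y.
  elim: n y => [//|n IHn] y /predU1P[->|/predU1P[-> //|]]; last exact: IHn.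
  by have [] := gP (n, h n) IHn.
have h_mono n m y : (n <= m)%N -> y \in (h n) -> y \in (h m).
  move=> /subnK <- hy; elim: (m - n)%N => [//|k IHk].
  by rewrite addSn /= !inE IHk !orbT.
(* A listed point stays listed, so all later terms lie in its successive basic neighbourhoods. *)
have cvg_h n y : y \in (h n) -> x @ \oo --> y.
  move=> hy V /(UP y).2[N _ NV]; exists (maxn n N) => // m /=.
  rewrite geq_max => /andP[lenm leNm]; apply: (NV m leNm).
  by have [_] := gP (m, h m) (hA m); apply; exact: h_mono hy.
exists x; split=> n.
- by have [] := gP (n, h n) (hA n).
- by apply: (cvg_h n.+1); rewrite mem_head.
- by apply: (cvg_h n.+1); rewrite !inE eqxx orbT.
Qed.

Lemma irreducible_countably_directed (X : topologicalType) (A : set X) :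
  first_countable X -> omega_well_filtered X -> closed A -> irreducible_set A ->
  countably_directed spec_le A.
Proof.
move=> fcX [_ wfX] cA Airr; split=> [|C C0 cC CA]; first by case: Airr.
have [c Cc] := countable_range _ _ C0 cC.
have Ac n : A (c n) by apply: CA; rewrite Cc; exists n.
have [x [Ax xx xc]] := irreducible_seq _ A c fcX Airr Ac.
pose K n := [set z | exists2 m, (n <= m)%N & spec_le (x m) z].
have K_mono n m : (n <= m)%N -> K m `<=` K n.
  by move=> lenm z [k lemk xz]; exists k => //; exact: leq_trans lemk.
have Kfilt : filtered_family (range K).
  split=> [|_ _ [n _ <-] [m _ <-]]; first by exists (K 0%N); exists 0%N.
  exists (K (maxn n m)); first by exists (maxn n m).
  by move=> z Kz; split; apply: K_mono Kz; rewrite ?leq_maxl ?leq_maxr.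
have [u [Ku Au]] : (\bigcap_i K i) `&` A !=set0.
  (* Otherwise some [K n] would lie in the open complement of [A], although [x n] belongs to
     both. *)
  apply: contrapT => KA0.
  have [|n KnA] := wfX K (fun n => tail_compact_saturated _ x n (xx n)) Kfilt
    _ (closed_openC cA).
    by move=> z Kz Az; apply: KA0; exists z.
  by apply: (KnA (x n)) (Ax n); exists n => //; exact: spec_le_refl.
exists u => // y; rewrite Cc => -[n _ <-].
(* [u] is above terms of arbitrarily large index, and these enter every neighbourhood of [c n]. *)
apply/spec_leP => B /nbhs_interior/(xc n)[N _ NB].
have [m leNm /spec_leP xu] := Ku N I.
exact: xu (NB m leNm).
Qed.

Lemma countably_directed_closure_irreducible (X : topologicalType) (D : set X) :
  countably_directed spec_le D -> irreducible_set (closure D).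
Proof.
move=> [[d Dd] Ddir]; split=> [|F1 F2 cF1 cF2 DF].
  by exists d; exact: subset_closure.
have closure_sub F : closed F -> D `<=` F -> closure D `<=` F.
  by move=> cF /closureS; rewrite -(closure_id F).1.
(* Closed sets are lower sets: if [x] in [D] avoids [F1], so does any upper bound of [x] and [y],
   which must then lie in [F2] and bring [y] with it. *)
have [DF1|/existsNP[x /not_implyP[Dx F1x]]] := pselect (D `<=` F1).
  by left; exact: closure_sub.
right; apply: closure_sub => // y Dy.
have [|||u Du xyu] := Ddir [set x; y].
- by exists x; left.
- exact/finite_set_countable/finite_set2.
- by move=> _ [->|->].
have [F1u|F2u] := DF u (subset_closure Du).
  by case: F1x; apply: closed_spec_le F1u => //; apply: xyu; left.
by apply: closed_spec_le F2u => //; apply: xyu; right.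
Qed.

Theorem corollary7p2 (X : topologicalType) (hfc : first_countable X)
    (hwf : omega_well_filtered X) :
  (forall A : set X, closed A -> irreducible_set A ->
     countably_directed spec_le A) /\
  omega_star_DC X.
Proof.
have dirA A := irreducible_countably_directed X A hfc hwf.
split=> //; split=> [|A]; first by case: hwf.
split=> [[cA Airr]|[D Ddir ->]].
  by exists A; [exact: dirA|exact/closure_id].
by split; [exact: closed_closure|exact: countably_directed_closure_irreducible].
Qed.
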